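(* With the notation of the context, conditionally on $\mathcal{A}_n$ and on the choice of $x_{n+1}$, the criterion $J_n^{\mathrm{Var}}(x_{n+1})=\mathrm{Var}_{G_{n+1}}(q_{n+1}\mid A_{n+1})$ satisfies $$\begin{aligned}J_n^{\mathrm{Var}}(x_{n+1})=&\sum_{i=1}^{L}\left[k_n(x_{n+1}^q(B_i),x_{n+1})\right]^2V(s_n(x_{n+1}),I_{i+1},I_i)\,P_i\\&+\sum_{i=1}^{L}\left[m_n(x_{n+1}^q(B_i))-k_n(x_{n+1}^q(B_i),x_{n+1})\,E(s_n(x_{n+1}),I_{i+1},I_i)\right]^2(1-P_i)P_i\\&-2\sum_{i=2}^{L}\sum_{j=1}^{i-1}\left[m_n(x_{n+1}^q(B_i))-k_n(x_{n+1}^q(B_i),x_{n+1})\,E(s_n(x_{n+1}),I_{i+1},I_i)\right]P_i\\&\qquad\times\left[m_n(x_{n+1}^q(B_j))-k_n(x_{n+1}^q(B_j),x_{n+1})\,E(s_n(x_{n+1}),I_{j+1},I_j)\right]P_j,\end{aligned}$$ where $$P_i=\Phi(s_n(x_{n+1})I_{i+1})-\Phi(s_n(x_{n+1})I_i),$$ $$E(s_n(x_{n+1}),I_{i+1},I_i)=\frac{1}{s_n(x_{n+1})}\left(\frac{\phi(s_n(x_{n+1})I_{i+1})-\phi(s_n(x_{n+1})I_i)}{\Phi(s_n(x_{n+1})I_{i+1})-\Phi(s_n(x_{n+1})I_i)}\right),$$ $$V(s_n(x_{n+1}),I_{i+1},I_i)=\frac{1}{s_n(x_{n+1})^2}\left[1+\frac{s_n(x_{n+1})\phi(I_{i+1})-s_n(x_{n+1})\phi(I_i)}{\Phi(I_{i+1})-\Phi(I_i)}-\left(\frac{\phi(I_{i+1})-\phi(I_i)}{\Phi(I_{i+1})-\Phi(I_i)}\right)^2\right],$$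 and $\Phi$ and $\phi$ are respectively the cumulative distribution function and the density function of the standard Gaussian law.
   Context: Gaussian process model. A function $g:\mathbb{X}\subset\mathbb{R}^d\to\mathbb{R}$ is modelled as a realization of a Gaussian process $G$ on $\mathbb{X}$ with known mean and covariance function. Given observations $\mathcal{A}_n=\{(x_1,g_1),\dots,(x_n,g_n)\}$ with $g_i=g(x_i)$, the conditional law of $G$ given $\mathcal{A}_n$ is that of a Gaussian process with mean $m_n(x)=\mathbb{E}(G(x)\mid\mathcal{A}_n)$ and covariance $k_n(x,x')=\mathrm{Cov}(G(x),G(x')\mid\mathcal{A}_n)$; $s_n^2(x)=k_n(x,x)$. For a candidate point $x_{n+1}\in\mathbb{X}$ with observed value $g_{n+1}$, the updated conditional mean is $m_{n+1}(x)=m_n(x)+k_n(x_{n+1},x)\,z$ with $z=\frac{g_{n+1}-m_n(x_{n+1})}{s_n^2(x_{n+1})}$. Percentile points. The input $X$ is a random vector with values in $\mathbb{X}$, and $\alpha\in\,]0,1[$ is a fixed level. Let $x_{MC}^1,\dots,x_{MC}^l$ be an independent sample distributed as $X$. At step $n$ the estimator $q_n$ of the $\alpha$-percentile is the $(\lfloor l\alpha\rfloor+1)$-th smallest of the values $m_n(x_{MC}^1),\dots,m_n(x_{MC}^l)$; $q_{n+1}$ is defined in the same way from $m_{n+1}$. For fixed $x_{n+1}$ put $b_j=m_n(x_{MC}^j)$, $a_j=k_n(x_{MC}^j,x_{n+1})$, so that $m_{n+1}(x_{MC}^j)=b_j+a_jz$ is a straight line in $z$. There are at most $L=\frac{l(l-1)}{2}$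 intersection points of these lines, with abscissae denoted $I_1,\dots,I_L$ in increasing order; $I_0=-\infty$, $I_{L+1}=+\infty$, and $B_i=[I_i,I_{i+1}]$ for $0\le i\le L$. For $z\in B_i$ the order of the lines is fixed; if $j_i$ is the index of the $(\lfloor l\alpha\rfloor+1)$-th lowest line on $B_i$, the percentile point of $B_i$ is $x_{n+1}^q(B_i)=x_{MC}^{j_i}$. Thus $q_{n+1}=\sum_{i=0}^{L}m_{n+1}(x_{n+1}^q(B_i))\mathbf{1}_{z\in B_i}$. In the claim, $B_i$ and $L$ denote the effective intervals and number of intervals, that is, the intervals for which the percentile points are different. Criterion. The unknown value $g_{n+1}$ is replaced by the random variable $G_{n+1}=G(x_{n+1})$, distributed according to its law conditional on $\mathcal{A}_n$; $A_{n+1}$ denotes the conditioning on $\mathcal{A}_n\cup(x_{n+1},G_{n+1})$ with $G_{n+1}$ random, and $\mathrm{Var}_{G_{n+1}}(q_{n+1}\mid A_{n+1})$ is the variance of $q_{n+1}$ over the randomness of $G_{n+1}$.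
   Formalization: The printed V is false (it can give a negative variance); with D=Φ(sI_{i+1})-Φ(sI_i) it is replaced by V=s^{-2}[1-(sI_{i+1}φ(sI_{i+1})-sI_iφ(sI_i))/D-((φ(sI_{i+1})-φ(sI_i))/D)^2]; s_n(x_{n+1})>0 is assumed, and effective cells are numbered 1..L with I_1=-∞, I_{L+1}=+∞. *)

(* Defs.v *)
From HB Require Import structures.
From mathcomp Require Import all_boot all_order all_algebra.
From mathcomp Require Import all_classical all_reals all_analysis.
From mathcomp Require Import measurable_realfun.

Set Implicit Arguments.
Unset Strict Implicit.
Unset Printing Implicit Defensive.

Import Order.TTheory GRing.Theory Num.Theory.
Import numFieldNormedType.Exports.

Local Open Scope classical_set_scope.
Local Open Scope ring_scope.

(* The library's [normal_prob m 0] is not the point mass at [m], so the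
   degenerate case is treated apart. *)
Definition gaussian_law (R : realType) (m v : R) :
    set (measurableTypeR R) -> \bar R :=
  if v == 0 then \d_m else normal_prob m (Num.sqrt v).

Definition gaussian_process (R : realType) (d : measure_display)
    (Omega : measurableType d) (T : Type) (P : probability Omega R)
    (G : T -> {mfun Omega >-> R}) : Prop :=
  forall (p : nat) (t : 'I_p -> T) (c : 'I_p -> R),
    exists m v : R, 0 <= v /\
      forall A : set (measurableTypeR R), measurable A ->
        P [set w | A (\sum_(i < p) c i * G (t i) w)] = gaussian_law m v A.

Definition mean_function (R : realType) (d : measure_display)
    (Omega : measurableType d) (T : Type) (P : probability Omega R)
    (G : T -> {mfun Omega >-> R}) (m : T -> R) : Prop :=
  forall x, ('E_P[G x] = (m x)%:E)%E.

Definition covariance_function (R : realType) (d : measure_display)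
    (Omega : measurableType d) (T : Type) (P : probability Omega R)
    (G : T -> {mfun Omega >-> R}) (k : T -> T -> R) : Prop :=
  forall x y, (covariance P (G x) (G y) = (k x y)%:E)%E.

(* [kappa y] is the law on [Omega] conditional on [Y = y], in the sense of a
   regular conditional probability. *)
Definition conditional_law (R : realType) (d d' : measure_display)
    (Omega : measurableType d) (S : measurableType d')
    (P : probability Omega R) (Y : Omega -> S)
    (kappa : S -> probability Omega R) : Prop :=
  (forall A, measurable A -> measurable_fun [set: S] (kappa ^~ A)) /\
  (forall A B, measurable A -> measurable B ->
    (P (A `&` (Y @^-1` B)) = \int[P]_(w in Y @^-1` B) kappa (Y w) A)%E).

Definition updated_mean (R : realType) (T : Type) (m : T -> R)
    (k : T -> T -> R) (xnew : T) (gnew : R) (x : T) : R :=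
  m x + k xnew x * ((gnew - m xnew) / k xnew xnew).

(* The (floor (l alpha) + 1)-th smallest of the values [v j]; [nth] counts
   from 0. *)
Definition percentile (R : realType) (alpha : R) (l : nat) (v : 'I_l -> R) : R :=
  nth 0 (sort <=%R [seq v j | j <- enum 'I_l]) (Num.truncn (l%:R * alpha)).

Definition J_Var (R : realType) (d : measure_display)
    (Omega : measurableType d) (T : Type) (P : probability Omega R)
    (G : T -> {mfun Omega >-> R}) (m : T -> R) (k : T -> T -> R)
    (alpha : R) (l : nat) (xMC : 'I_l -> T) (xnew : T) : \bar R :=
  ('V_P[fun w => percentile alpha
          (fun j => updated_mean m k xnew (G xnew w) (xMC j))])%E.

(* Increasing list of the distinct abscissae at which two of the lines
   [z |-> b j + a j * z] intersect; parallel lines are discarded. *)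
Definition crossings (R : realType) (l : nat) (b a : 'I_l -> R) : seq R :=
  sort <=%R (undup
    [seq (b p.2 - b p.1) / (a p.1 - a p.2)
    | p : 'I_l * 'I_l <- enum {: 'I_l * 'I_l}
    & (p.1 < p.2)%N && (a p.1 != a p.2)]).

(* I_0 = -oo, I_1, ..., I_L, I_(L+1) = +oo for [s] = [:: I_1; ...; I_L]. *)
Definition cell_bounds (R : realType) (s : seq R) : seq (\bar R) :=
  -oo%E :: rcons [seq z%:E%E | z <- s] +oo%E.

(* On [lo, hi] the line of index [j] is the (floor (l alpha) + 1)-th lowest. *)
Definition percentile_line (R : realType) (alpha : R) (l : nat)
    (b a : 'I_l -> R) (lo hi : \bar R) (j : 'I_l) : Prop :=
  forall z : R, (lo <= z%:E <= hi)%E ->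
    b j + a j * z = percentile alpha (fun p => b p + a p * z).

(* Given [s] = [:: I_1; ...; I_L] and the percentile points [y i] of the
   intervals B_i (0 <= i <= L), the indices [i] of the abscissae I_i that
   separate two intervals with different percentile points; adjacent intervals
   with the same percentile point are merged. *)
Definition effective_indices (R : realType) (T : eqType) (s : seq R)
    (y : nat -> T) : seq nat :=
  [seq i <- iota 1 (size s) | y i.-1 != y i].

Definition effective_bounds (R : realType) (T : eqType) (s : seq R)
    (y : nat -> T) : seq (\bar R) :=
  cell_bounds [seq nth 0 s i.-1 | i <- effective_indices s y].

Definition effective_points (R : realType) (T : eqType) (s : seq R)
    (y : nat -> T) : seq T :=
  y 0%N :: [seq y i | i <- effective_indices s y].

(* Standard Gaussian distribution function and density, with their limit
   values at -oo and +oo. *)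
Definition std_cdf (R : realType) (x : \bar R) : R :=
  fine (normal_prob 0 1 [set y : R | (y%:E <= x)%E]).

Definition std_pdf (R : realType) (x : \bar R) : R :=
  if x is r%:E%E then normal_pdf 0 1 r else 0.

Definition cell_P (R : realType) (s : R) (hi lo : \bar R) : R :=
  std_cdf (s%:E * hi)%E - std_cdf (s%:E * lo)%E.

Definition cell_E (R : realType) (s : R) (hi lo : \bar R) : R :=
  s^-1 * ((std_pdf (s%:E * hi)%E - std_pdf (s%:E * lo)%E) /
          (std_cdf (s%:E * hi)%E - std_cdf (s%:E * lo)%E)).

(* Variance of a centered Gaussian variable of standard deviation [s^-1]
   conditioned to lie in [lo, hi].  The source prints
     1 + (s phi(hi) - s phi(lo)) / (Phi(hi) - Phi(lo))
       - ((phi(hi) - phi(lo)) / (Phi(hi) - Phi(lo)))^2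
   between the brackets, which is a misprint: it can be negative.  [fine] sends
   an infinite bound to 0; the density vanishes there, so that the product is
   the limit 0 of x phi(x). *)
Definition cell_V (R : realType) (s : R) (hi lo : \bar R) : R :=
  (s ^+ 2)^-1 *
  (1 - (fine (s%:E * hi)%E * std_pdf (s%:E * hi)%E -
        fine (s%:E * lo)%E * std_pdf (s%:E * lo)%E) /
       (std_cdf (s%:E * hi)%E - std_cdf (s%:E * lo)%E)
     - ((std_pdf (s%:E * hi)%E - std_pdf (s%:E * lo)%E) /
        (std_cdf (s%:E * hi)%E - std_cdf (s%:E * lo)%E)) ^+ 2).

(* Main.v *)
(** Conditionally on the observations, W = (G(xnew) - mn xnew) / s is standard
    Gaussian, and q_{n+1} is a piecewise affine function of W, whose pieces are
    delimited by the effective bounds multiplied by s.  The variance of such a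
    function only involves the integrals of 1, x and x^2 over the pieces; they
    are explicit because - phi is an antiderivative of x phi(x), and
    - x phi(x) one of (x^2 - 1) phi(x). *)

Require Import Defs.
From HB Require Import structures.
From mathcomp Require Import all_boot all_order all_algebra.
From mathcomp Require Import all_classical all_reals all_analysis.
From mathcomp Require Import measurable_realfun.
From mathcomp Require Import ring lra.

Import Order.TTheory GRing.Theory Num.Theory.
Import numFieldNormedType.Exports.

Local Open Scope classical_set_scope.
Local Open Scope ring_scope.

(** On cell i the variable z = W / s has conditional mean - E_i and conditional variance V_i, so mn
    - kn E_i is the conditional mean of q_{n+1} there. The first sum of the formula is thus the
    variance within the cells, and the other two are the variance of the conditional means.
    Integrals are computed on half-lines ending at an extended real, so that unbounded cells need no
    separate treatment. The cells are half-open, and the one containing x is indexed by the number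
    of breakpoints strictly below x. The Gaussian hypothesis yields a law of G(xnew) with
    unspecified parameters; they are identified through the first two moments, and the degenerate
    law can only be excluded afterwards. *)

(** * Integration against a normal law through its density *)

Section normal_density_transfer.
Context {R : realType}.
Implicit Types (m s : R) (D : set (measurableTypeR R)).
Local Notation mu := (@lebesgue_measure R).
Local Open Scope ereal_scope.

(** The Radon-Nikodym derivative of the normal law and [normal_pdf] have the same integral over
    every measurable set, hence agree almost everywhere. *)
Lemma ge0_integral_normal_prob m s D (f : measurableTypeR R -> \bar R) :
  measurable D -> measurable_fun D f -> (forall x, 0 <= f x) ->
  \int[normal_prob m s]_(x in D) f x =
  \int[mu]_(x in D) (f x * (normal_pdf m s x)%:E).
Proof.
move=> mD mf f0; have dom := normal_prob_dominates m s.
rewrite -(Radon_Nikodym_SigmaFinite.change_of_variables dom f0 mD mf).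
have mpdf : measurable_fun D (EFin \o normal_pdf m s).
  by apply/measurable_EFinP/measurable_funTS; exact: measurable_normal_pdf.
have iRN : mu.-integrable D
    (Radon_Nikodym_SigmaFinite.f (normal_prob m s) mu).
  apply: (integrableS measurableT) => //.
  exact: Radon_Nikodym_SigmaFinite.f_integrable.
apply: ae_eq_integral => //.
- by apply: emeasurable_funM => //; exact: measurable_int iRN.
- exact: emeasurable_funM.
- apply: ae_eqe_mul2l; apply: integral_ae_eq => // E ED mE.
  by rewrite -Radon_Nikodym_SigmaFinite.f_integral.
Qed.

Lemma integrable_normal_prob m s D (f : measurableTypeR R -> R) :
  measurable D -> measurable_fun D f ->
  mu.-integrable D (fun x => (f x * normal_pdf m s x)%:E) ->
  (normal_prob m s).-integrable D (EFin \o f).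
Proof.
move=> mD mf /integrableP[_ fpdf]; apply/integrableP; split.
  exact/measurable_EFinP.
rewrite ge0_integral_normal_prob//; last first.
  by apply/measurableT_comp => //; exact/measurable_EFinP.
apply: le_lt_trans fpdf; rewrite le_eqVlt; apply/orP; left; apply/eqP.
apply: eq_integral => x _ /=.
by rewrite normrM (ger0_norm (normal_pdf_ge0 _ _ _)) EFinM.
Qed.

Lemma integral_normal_prob m s D (f : measurableTypeR R -> R) :
  measurable D -> measurable_fun D f ->
  \int[normal_prob m s]_(x in D) (f x)%:E =
  \int[mu]_(x in D) (f x * normal_pdf m s x)%:E.
Proof.
move=> mD /measurable_EFinP mf; rewrite [LHS]integralE [RHS]integralE.
congr (_ - _); rewrite ge0_integral_normal_prob//.
- apply: eq_integral => x _; rewrite funeposE /= -EFin_max -EFinM.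
  by rewrite maxr_pMl ?normal_pdf_ge0// mul0r funeposE EFin_max.
- exact: measurable_funepos.
- apply: eq_integral => x _; rewrite funenegE /= -EFin_max -EFinM.
  by rewrite maxr_pMl ?normal_pdf_ge0// mul0r mulNr funenegE EFin_max.
- exact: measurable_funeneg.
Qed.

End normal_density_transfer.

(** * Integrals over half-lines *)

(** Monotone convergence applies to the positive and negative parts separately; integrability on the
    union makes the difference of the limits meaningful. *)
Lemma nondecreasing_cvg_integral {d} {T : measurableType d} {R : realType}
    (mu : {measure set T -> \bar R}) (A : (set T)^nat) (f : T -> \bar R) :
  {homo A : n m / (n <= m)%N >-> (n <= m)%O} ->
  (forall n, measurable (A n)) -> mu.-integrable (\bigcup_n A n) f ->
  (\int[mu]_(x in A n) f x @[n --> \oo] -->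
   \int[mu]_(x in \bigcup_n A n) f x)%E.
Proof.
move=> ndA mA intf; rewrite [X in _ --> X]integralE.
rewrite (_ : (fun _ => _) = (fun n => \int[mu]_(x in A n) f^\+ x -
    \int[mu]_(x in A n) f^\- x)%E); last by apply/funext => n; rewrite -integralE.
have mf n : measurable_fun (A n) f.
  by apply: measurable_funS (measurable_int _ intf) => //;
    [exact: bigcup_measurable|exact: bigcup_sup].
have mUA : measurable (\bigcup_n A n) by exact: bigcup_measurable.
apply: cvgeB.
- by rewrite fin_num_adde_defl// fin_numN integrable_neg_fin_num.
- apply: ge0_nondecreasing_set_cvg_integral => // n.
  exact: measurable_funepos.
- apply: ge0_nondecreasing_set_cvg_integral => // n.
  exact: measurable_funeneg.
Qed.

Section FTC_halfline.
Context {R : realType}.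
Variables f F : R -> R.
Local Notation mu := (@lebesgue_measure R).
Hypotheses (cf : continuous f) (intf : mu.-integrable setT (EFin \o f)).
Hypotheses (dF : forall x : R, is_derive x 1 F (f x)) (FNy : F x @[x --> -oo] --> 0).

(** The half-line is exhausted by compact intervals, and the boundary term at their left end tends
    to 0. Integrability stands in for a sign condition, since x phi(x) changes sign. *)
Lemma integrable_FTC2Ny (t : R) : (\int[mu]_(x in `]-oo, t]) (f x)%:E = (F t)%:E)%E.
Proof.
(* The successor keeps the interval nondegenerate for n = 0, as [continuous_FTC2] requires. *)
pose A (n : nat) : set R := `[t - n.+1%:R, t]%classic.
have UA : \bigcup_n A n = `]-oo, t]%classic.
  apply/seteqP; split => [x [n _]|x]; rewrite /A /= !in_itv/=.
    by case/andP.
  move=> xt; exists (Num.truncn (t - x)) => //=.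
  rewrite in_itv/= xt andbT lerBlDr -lerBlDl; apply/ltW.
  by rewrite truncnS_gt.
have := @nondecreasing_cvg_integral _ _ _ mu A (EFin \o f).
rewrite UA => /(_ _ _ _)/cvg_lim => <- //.
- apply: cvg_lim => //.
  rewrite (_ : (fun _ => _) = (fun n => (F t - F (t - n.+1%:R))%:E)); last first.
    apply/funext => n; rewrite /A EFinB (@continuous_FTC2 _ _ F)//.
    + by rewrite ltrBlDr ltrDl ltr0n.
    + exact: continuous_subspaceT.
    + split => [x _| |]; first exact: (@ex_derive _ _ _ _ _ _ _ (dF x)).
      * apply: cvg_at_right_filter; apply: differentiable_continuous.
        by apply/derivable1_diffP; exact: (@ex_derive _ _ _ _ _ _ _ (dF _)).
      * apply: cvg_at_left_filter; apply: differentiable_continuous.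
        by apply/derivable1_diffP; exact: (@ex_derive _ _ _ _ _ _ _ (dF _)).
    + by move=> x _; rewrite derive1E; exact: (@derive_val _ _ _ _ _ _ _ (dF x)).
  apply: cvg_EFin; first by near=> n.
  rewrite /comp /= -[X in _ --> X]subr0.
  apply: cvgB; first exact: cvg_cst.
  apply: (cvg_comp (fun n : nat => t - n.+1%:R) F _ FNy).
  apply/cvgrNyPle => M; near=> n; rewrite lerBlDl -lerBlDr -natr1.
  by rewrite (@le_trans _ _ n%:R) ?lerDl//; near: n; exact: nbhs_infty_ger.
- move=> m n mn; apply/subsetPset/subset_itvr; rewrite bnd_simp lerB//.
  by rewrite ler_nat.
- by move=> n; exact: measurable_itv.
- exact: integrableS intf.
Unshelve. all: by end_near.
Qed.

Lemma integrable_FTC2T : F x @[x --> +oo] --> 0 ->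
  (\int[mu]_x (f x)%:E = 0)%E.
Proof.
move=> Fy; pose A (n : nat) : set R := `]-oo, n%:R]%classic.
have UA : \bigcup_n A n = setT.
  apply/seteqP; split => // x _; exists (Num.truncn x).+1 => //=.
  by rewrite /A /= in_itv/= ltW// truncnS_gt.
have := @nondecreasing_cvg_integral _ _ _ mu A (EFin \o f).
rewrite UA => /(_ _ _ _)/cvg_lim => <- //.
- apply: cvg_lim => //.
  under eq_fun do rewrite /A /= integrable_FTC2Ny.
  apply: cvg_EFin; first by near=> n.
  by apply: (cvg_comp _ F _ Fy); exact: cvgr_idn.
- move=> m n mn; apply/subsetPset/subset_itvl; rewrite bnd_simp ler_nat//.
- by move=> n; exact: measurable_itv.
Unshelve. all: by end_near.
Qed.

End FTC_halfline.

(** * Truncated moments of the standard normal law *)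

Section standard_normal.
Context {R : realType}.
Implicit Types x t : R.
Local Notation mu := (@lebesgue_measure R).
Local Notation phi := (@normal_pdf R 0 1).

Lemma std_normal_pdfE x : phi x = normal_peak 1 * expR (- (x ^+ 2 / 2)).
Proof.
by rewrite normal_pdfE ?oner_eq0// /normal_fun subr0 expr1n mulNr.
Qed.

Lemma std_normal_pdfN x : phi (- x) = phi x.
Proof. by rewrite !std_normal_pdfE sqrrN. Qed.

Lemma is_derive_std_normal_pdf x : is_derive x (1 : R) phi (- (x * phi x)).
Proof.
rewrite (_ : phi = fun y => normal_peak 1 * expR (- (y ^+ 2 / 2))); last first.
  by apply/funext => y; rewrite std_normal_pdfE.
apply: is_derive_eq.
by rewrite /GRing.scale /=; field.
Qed.

Lemma is_derive_id_std_normal_pdf x :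
  is_derive x (1 : R) (fun y => - (y * phi y)) ((x ^+ 2 - 1) * phi x).
Proof.
have dphi := is_derive_std_normal_pdf x.
apply: is_derive_eq.
by rewrite /GRing.scale /=; field.
Qed.

(* Domination by the centered normal density of variance 2, which makes the
   second moment integrable. *)
Lemma sqr_std_normal_pdf_le x : x ^+ 2 * phi x <=
  4 * normal_peak 1 / normal_peak (Num.sqrt 2) * normal_pdf 0 (Num.sqrt 2) x.
Proof.
have s20 : Num.sqrt 2 != 0 :> R by rewrite sqrtr_eq0 -ltNge.
rewrite (normal_pdfE _ s20) /normal_fun std_normal_pdfE subr0.
rewrite sqr_sqrtr// mulrA divfK; last by rewrite gt_eqF// normal_peak_gt0.
(* One half of the exponent absorbs x^2, the other is that of the density of variance 2. With y =
   x^2 / 4, the bound exp y >= 1 + y gives x^2 <= 4 exp y, whence the factor 4. *)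
rewrite (_ : - (x ^+ 2 / 2) = - (x ^+ 2 / 4) + - x ^+ 2 / (2 *+ 2)); last by field.
have x2e : x ^+ 2 * expR (- (x ^+ 2 / 4)) <= 4.
  rewrite expRN ler_pdivrMr ?expR_gt0//.
  by have := expR_ge1Dx (x ^+ 2 / 4); lra.
rewrite expRD; set e := expR (- x ^+ 2 / _).
have -> : x ^+ 2 * (normal_peak 1 * (expR (- (x ^+ 2 / 4)) * e)) =
  x ^+ 2 * expR (- (x ^+ 2 / 4)) * (normal_peak 1 * e) by ring.
by rewrite -[leRHS]mulrA ler_wpM2r// mulr_ge0 ?normal_peak_ge0 ?expR_ge0.
Qed.

Lemma integrable_sqr_std_normal_pdf :
  mu.-integrable setT (EFin \o (fun x => x ^+ 2 * phi x)).
Proof.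
have mphi := @measurable_normal_pdf R 0 1.
have /integrableZl := integrable_normal_pdf (0 : R) (Num.sqrt 2).
move=> /(_ measurableT (4 * normal_peak 1 / normal_peak (Num.sqrt 2))).
apply: le_integrable => //.
- by apply/measurable_EFinP; apply: measurable_funM.
- move=> x _; rewrite /= lee_fin !ger0_norm ?sqr_std_normal_pdf_le//.
  + by rewrite !mulr_ge0 ?normal_pdf_ge0 ?invr_ge0 ?normal_peak_ge0.
  + by rewrite mulr_ge0 ?normal_pdf_ge0 ?sqr_ge0.
Qed.

(** Domination by (1 + x^2) phi(x). *)
Lemma integrable_id_std_normal_pdf :
  mu.-integrable setT (EFin \o (fun x => x * phi x)).
Proof.
have mphi := @measurable_normal_pdf R 0 1.
apply: le_integrable (integrableD _ (integrable_normal_pdf (0 : R) 1)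
  integrable_sqr_std_normal_pdf) => //.
- by apply/measurable_EFinP; apply: measurable_funM.
- move=> x _; rewrite /= lee_fin normrM (ger0_norm (normal_pdf_ge0 _ _ _)).
  rewrite -[X in `|X + _|]mul1r -mulrDl normrM.
  rewrite (ger0_norm (normal_pdf_ge0 _ _ _)) ler_wpM2r ?normal_pdf_ge0//.
  rewrite [leRHS]ger0_norm ?addr_ge0 ?sqr_ge0//.
  have : 0 <= (`|x| - 1) ^+ 2 by exact: sqr_ge0.
  rewrite -[x ^+ 2]real_normK ?num_real//; have := normr_ge0 x; nra.
Qed.

Lemma cvg_id_std_normal_pdf : x * phi x @[x --> +oo] --> 0.
Proof.
apply: (@squeeze_cvgr _ _ _ _ (fun=> 0) (fun x => 2 * normal_peak 1 * x^-1)).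
- near=> x; have x0 : 0 < x by near: x; exact: nbhs_pinfty_gt.
  rewrite mulr_ge0 ?normal_pdf_ge0 ?(ltW x0)//= std_normal_pdfE.
  (* This is x^2 <= 2 exp(x^2 / 2), again from exp y >= 1 + y. *)
  have e2 : x * expR (- (x ^+ 2 / 2)) <= 2 * x^-1.
    rewrite ler_pdivlMr// expRN mulrAC ler_pdivrMr ?expR_gt0//.
    by have := expR_ge1Dx (x ^+ 2 / 2); lra.
  have := ler_wpM2l (normal_peak_ge0 1) e2.
  by rewrite mulrCA (mulrCA _ 2) [leRHS]mulrA; exact.
- exact: cvg_cst.
- rewrite -[X in _ --> X](mulr0 (2 * normal_peak 1)).
  by apply: cvgM; [exact: cvg_cst|apply/gtr0_cvgV0 => //; exact: nbhs_pinfty_gt].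
Unshelve. all: by end_near.
Qed.

Lemma cvg_std_normal_pdf : phi x @[x --> +oo] --> 0.
Proof.
apply: (@squeeze_cvgr _ _ _ _ (fun=> 0) (fun x => x * phi x)).
- near=> x; have x1 : 1 <= x by near: x; exact: nbhs_pinfty_ge.
  by rewrite normal_pdf_ge0/= ler_peMl ?normal_pdf_ge0.
- exact: cvg_cst.
- exact: cvg_id_std_normal_pdf.
Unshelve. all: by end_near.
Qed.

Lemma continuous_id_std_normal_pdf : continuous (fun x => x * phi x).
Proof.
move=> x; apply: cvgM; [exact: cvg_id|exact: continuous_normal_pdf].
Qed.

Lemma set_le_EFin (r : R) : [set x : R | (x%:E <= r%:E)%E] = `]-oo, r]%classic.
Proof. by apply/seteqP; split => x; rewrite /= in_itv/= lee_fin. Qed.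

Lemma set_le_pinfty : [set x : R | (x%:E <= +oo)%E] = setT.
Proof. by apply/seteqP; split => x //= _; rewrite leey. Qed.

Lemma set_le_ninfty : [set x : R | (x%:E <= -oo)%E] = set0.
Proof. by apply/seteqP; split => x //=; rewrite leNgt ltNyr. Qed.

Lemma measurable_set_le (t : \bar R) :
  measurable [set x : measurableTypeR R | (x%:E <= t)%E].
Proof.
by case: t => [r| |]; rewrite (set_le_EFin, set_le_pinfty, set_le_ninfty).
Qed.

(** The value 0 at both infinities is the limit of F there, in accordance with the conventions for
    [std_pdf t] and [fine t * std_pdf t]. *)
Lemma integrable_FTC2_set_le (f F : R -> R) (t : \bar R) :
    continuous f -> mu.-integrable setT (EFin \o f) ->
    (forall x : R, is_derive x (1 : R) F (f x)) ->
    F x @[x --> -oo] --> 0 -> F x @[x --> +oo] --> 0 ->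
  (\int[mu]_(x in [set x : R | x%:E <= t]) (f x)%:E =
   (if t is r%:E then F r else 0)%:E)%E.
Proof.
move=> cf intf dF FNy Fy; case: t => [r| |].
- by rewrite set_le_EFin (integrable_FTC2Ny _ _ cf).
- by rewrite set_le_pinfty (integrable_FTC2T _ _ cf intf dF).
- by rewrite set_le_ninfty integral_set0.
Qed.

Lemma integral_id_std_normal (t : \bar R) :
  (\int[normal_prob 0 1]_(x in [set x : measurableTypeR R | x%:E <= t]) x%:E =
   (- std_pdf t)%:E)%E.
Proof.
rewrite (integral_normal_prob _ _ _ idfun); last 2 first.
- exact: measurable_set_le.
- exact: measurable_id.
have phiy : - phi x @[x --> +oo] --> 0.
  by rewrite -[X in _ --> X]oppr0; exact: (cvgN cvg_std_normal_pdf).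
have dphi x : is_derive x (1 : R) (fun y => - phi y) (x * phi x).
  by have := is_deriveN (is_derive_std_normal_pdf x); rewrite opprK.
rewrite (integrable_FTC2_set_le _ _ t
  continuous_id_std_normal_pdf integrable_id_std_normal_pdf dphi)//.
- by rewrite /std_pdf; case: t => //; rewrite oppr0.
- rewrite cvgNy_compNP; apply: (cvg_trans _ phiy).
  by apply: near_eq_cvg; near=> x; rewrite /= std_normal_pdfN.
Unshelve. all: by end_near.
Qed.

Lemma integral_sqr_std_normal (t : \bar R) :
  (\int[normal_prob 0 1]_(x in [set x : measurableTypeR R | x%:E <= t])
     (x ^+ 2)%:E = (std_cdf t - fine t * std_pdf t)%:E)%E.
Proof.
have iphi : mu.-integrable setT (EFin \o phi) := integrable_normal_pdf 0 1.
have iphi2 : mu.-integrable setT (EFin \o (fun x => (x ^+ 2 - 1) * phi x)).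
  apply: eq_integrable (integrableB _ integrable_sqr_std_normal_pdf iphi) => //.
  by move=> x _; rewrite /= -EFinB mulrBl mul1r.
have mt := measurable_set_le t.
rewrite (integral_normal_prob _ _ _ (fun x => x ^+ 2))//.
(* Only (x^2 - 1) phi(x) has an explicit antiderivative; the term phi(x) added back integrates to
   [std_cdf t]. *)
transitivity (\int[mu]_(x in [set x : R | (x%:E <= t)%E])
    (((x ^+ 2 - 1) * phi x)%:E + (phi x)%:E))%E.
  by apply: eq_integral => x _; rewrite /= -EFinD mulrBl mul1r subrK.
rewrite integralD//; last 2 first.
- exact: integrableS iphi2.
- exact: integrableS iphi.
rewrite (integrable_FTC2_set_le _ _ t _ iphi2 is_derive_id_std_normal_pdf).
- rewrite addrC EFinD; congr (_ + _)%E.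
    by rewrite /std_cdf fineK ?fin_num_measure.
  by case: t {mt} => [r| |] /=; rewrite ?mul0r ?oppr0.
- move=> x; apply: cvgM; last exact: continuous_normal_pdf.
  by apply: cvgB; [exact: sqr_continuous|exact: cvg_cst].
- rewrite cvgNy_compNP; apply: (cvg_trans _ cvg_id_std_normal_pdf).
  by apply: near_eq_cvg; near=> x; rewrite /= std_normal_pdfN mulNr opprK.
- by rewrite -[X in _ --> X]oppr0; exact: (cvgN cvg_id_std_normal_pdf).
Unshelve. all: by end_near.
Qed.

Lemma integrable_id_std_normal : (normal_prob 0 1).-integrable setT
  (EFin \o (id : measurableTypeR R -> measurableTypeR R)).
Proof.
apply: integrable_normal_prob => //.
exact: integrable_id_std_normal_pdf.
Qed.

Lemma integrable_sqr_std_normal : (normal_prob 0 1).-integrable setT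
  (EFin \o (fun x : measurableTypeR R => x ^+ 2)).
Proof.
apply: integrable_normal_prob => //.
exact: integrable_sqr_std_normal_pdf.
Qed.

End standard_normal.

(** * Change of variables along a law *)

Section law_transfer.
Context {R : realType} {d : measure_display} {T : measurableType d}.
Variables (mu : {measure set T -> \bar R}) (W : T -> measurableTypeR R).
Variable nu : {measure set (measurableTypeR R) -> \bar R}.
Hypothesis mW : measurable_fun setT W.
Hypothesis muW : forall A, measurable A -> mu (W @^-1` A) = nu A.

(** The measure [nu] is left general so as to cover both the standard Gaussian law and the point
    mass of the degenerate case. *)
Lemma integral_law (f : measurableTypeR R -> R) : measurable_fun setT f ->
  (\int[mu]_w (f (W w))%:E = \int[nu]_x (f x)%:E)%E.
Proof.
move=> /measurable_EFinP mf.
have ge0E (g : measurableTypeR R -> \bar R) : measurable_fun setT g ->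
    (forall x, (0 <= g x)%E) -> (\int[mu]_w (g (W w)) = \int[nu]_x g x)%E.
  move=> mg g0; transitivity (\int[pushforward mu W]_x g x)%E.
    by rewrite (ge0_integral_pushforward mW).
  by apply: eq_measure_integral => A mA _; rewrite -muW.
rewrite [LHS]integralE [RHS]integralE; congr (_ - _)%E.
  rewrite -ge0E//; last exact: measurable_funepos.
  by apply: eq_integral => w _; rewrite !funeposE.
rewrite -ge0E//; last exact: measurable_funeneg.
by apply: eq_integral => w _; rewrite !funenegE.
Qed.

End law_transfer.

(** * Integrals of quadratic polynomials over half-open cells *)

Section std_normal_cell.
Context {R : realType}.
Local Notation N := (normal_prob (0 : R) 1).
Local Notation le t := [set x : measurableTypeR R | (x%:E <= t)%E].
Local Notation cell lo hi := [set x : measurableTypeR R | (lo < x%:E <= hi)%E].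

Lemma measurable_cell (lo hi : \bar R) : measurable (cell lo hi).
Proof.
rewrite (_ : cell lo hi = le hi `\` le lo).
  by apply: measurableD; exact: measurable_set_le.
apply/seteqP; split => x /=; rewrite ltNge; first by case/andP => /negP.
by move=> [-> /negP ->].
Qed.

Lemma set_le_setU_cell (lo hi : \bar R) : (lo <= hi)%E ->
  le hi = le lo `|` cell lo hi.
Proof.
move=> lohi; apply/seteqP; split => x /=.
  by move=> ->; rewrite andbT; have [|] := leP x%:E lo; [left|right].
by case=> [/le_trans|/andP[]//]; exact.
Qed.

Lemma disjoint_set_le_cell (lo hi : \bar R) : [disjoint le lo & cell lo hi].
Proof.
apply/disj_setPS => x /= [xlo /andP[]].
by rewrite ltNge xlo.
Qed.

Lemma integral_poly2_set_le (c0 c1 c2 : R) (t : \bar R) :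
  (\int[N]_(x in le t) (c0 + c1 * x + c2 * x ^+ 2)%:E =
   (c0 * std_cdf t - c1 * std_pdf t
    + c2 * (std_cdf t - fine t * std_pdf t))%:E)%E.
Proof.
have mt := measurable_set_le t.
have i0 : N.-integrable (le t) (EFin \o cst c0).
  exact: finite_measure_integrable_cst.
have i1 : N.-integrable (le t) (EFin \o id).
  exact: integrableS integrable_id_std_normal.
have i2 : N.-integrable (le t) (EFin \o (fun x => x ^+ 2)).
  exact: integrableS integrable_sqr_std_normal.
have i1c := integrableZl mt c1 i1.
have i2c := integrableZl mt c2 i2.
transitivity (\int[N]_(x in le t) ((cst c0%:E x + c1%:E * (EFin \o id) x)
  + c2%:E * (EFin \o (fun x => x ^+ 2)%R) x))%E.
  by apply: eq_integral => x _.
rewrite integralD//; last exact: integrableD.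
rewrite integralD// !integralZl//= integral_id_std_normal.
rewrite integral_sqr_std_normal integral_cst//.
rewrite -[X in (c0%:E * X)%E]fineK ?fin_num_measure// -[fine _]/(std_cdf t).
by rewrite -!EFinM -!EFinD mulrN.
Qed.

Lemma integral_poly2_cell (c0 c1 c2 : R) (lo hi : \bar R) : (lo <= hi)%E ->
  (\int[N]_(x in cell lo hi) (c0 + c1 * x + c2 * x ^+ 2)%:E =
   (c0 * (std_cdf hi - std_cdf lo) - c1 * (std_pdf hi - std_pdf lo)
    + c2 * (std_cdf hi - std_cdf lo
            - (fine hi * std_pdf hi - fine lo * std_pdf lo)))%:E)%E.
Proof.
move=> lohi; have := integral_poly2_set_le c0 c1 c2 hi.
have mp : measurable_fun setT (fun x : measurableTypeR R =>
    (c0 + c1 * x + c2 * x ^+ 2)%:E).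
  apply/measurable_EFinP; apply: measurable_funD; last first.
    by apply: measurable_funM => //; exact: measurable_funX.
  by apply: measurable_funD => //; exact: measurable_funM.
rewrite (set_le_setU_cell _ _ lohi) integral_setU.
- rewrite integral_poly2_set_le.
  (* The unknown cell integral added to a real number gives a real number, which rules out infinite
     values. *)
  by case: (integral _ _ _) => [r| |] // [cellE]; congr EFin; lra.
- exact: measurable_set_le.
- exact: measurable_cell.
- exact: measurable_funTS.
- exact: disjoint_set_le_cell.
Qed.

(* On a cell of probability 0 the quotients in [cell_E] and [cell_V] are
   divisions by 0; there the numerators vanish too. *)
Lemma std_cdf_eq (lo hi : \bar R) : (lo <= hi)%E -> std_cdf hi = std_cdf lo ->
  std_pdf hi = std_pdf lo /\ fine hi * std_pdf hi = fine lo * std_pdf lo.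
Proof.
move=> lohi cdfE.
have Ncell : (N (cell lo hi) = 0)%E.
  have := integral_poly2_cell 1 0 0 _ _ lohi.
  under eq_integral do rewrite !mul0r !addr0.
  rewrite integral_cst; last exact: measurable_cell.
  by rewrite mul1e => ->; rewrite cdfE !mul0r subrr mulr0 subr0 addr0.
(* Integrals over a null cell vanish, and once the values of [std_cdf] agree only boundary terms
   remain. *)
have null c1 c2 :
  - c1 * (std_pdf hi - std_pdf lo)
    - c2 * (fine hi * std_pdf hi - fine lo * std_pdf lo) = 0.
  have := integral_poly2_cell 0 c1 c2 _ _ lohi.
  rewrite null_set_integral//.
  + by move=> [/esym]; rewrite cdfE subrr => <-; ring.
  + exact: measurable_cell.
  + apply/measurable_EFinP/measurable_funTS; apply: measurable_funD; last first.
      by apply: measurable_funM => //; exact: measurable_funX.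
    by apply: measurable_funD => //; exact: measurable_funM.
split; [have := null 1 0|have := null 0 1]; lra.
Qed.

End std_normal_cell.

(** * Piecewise affine functions of a standard Gaussian variable *)

Section piecewise_affine.
Context {R : realType}.
Local Notation N := (normal_prob (0 : R) 1).
Local Notation le t := [set x : measurableTypeR R | (x%:E <= t)%E].
Local Notation cell lo hi := [set x : measurableTypeR R | (lo < x%:E <= hi)%E].
Variable C : seq R.
Hypothesis sC : sorted <=%R C.
Local Notation n := (size C).
Local Notation B i := (nth +oo%E (cell_bounds C) i).

Lemma cell_boundsS (i : nat) : (i < n)%N -> B i.+1 = (nth 0 C i)%:E.
Proof.
by move=> iC; rewrite /cell_bounds/= nth_rcons size_map iC (nth_map 0).
Qed.

Lemma cell_bounds_last : B n.+1 = +oo%E.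
Proof. by rewrite /cell_bounds/= nth_rcons size_map ltnn eqxx. Qed.

Lemma cell_bounds_le (i : nat) : (i <= n)%N -> (B i <= B i.+1)%E.
Proof.
case: i => [|i] iC; first by rewrite /= leNye.
have [iC'|] := ltnP i.+1 n; last first.
  move=> Ci; have -> : i.+1 = n by apply/eqP; rewrite eqn_leq iC.
  by rewrite cell_bounds_last leey.
rewrite !cell_boundsS// lee_fin; apply: (sorted_leq_nth le_trans le_refl) => //.
Qed.

(** A repeated breakpoint produces an empty cell, whose index is never a value of the count; weak
    sorting of C is thus enough. *)
Lemma count_cell (x : R) :
  (B (count (< x)%R C) < x%:E <= B (count (< x)%R C).+1)%E.
Proof.
set k := count _ C; have kC : (k <= n)%N := count_size _ _.
apply/andP; split.
  case E : k => [|i]; first by rewrite /= ltNyr.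
  by rewrite cell_boundsS ?lte_fin ?nth_count_lt -/k ?E// -E.
have [kn|nk] := ltnP k n.
  by rewrite cell_boundsS// lee_fin nth_count_ge// leqnn.
have -> : k = n by apply/eqP; rewrite eqn_leq kC.
by rewrite cell_bounds_last leey.
Qed.

Lemma cell_count (x : R) (i : nat) : (i <= n)%N ->
  (B i < x%:E <= B i.+1)%E -> count (< x) C = i.
Proof.
move=> iC /andP[Bix xBi]; apply/eqP; rewrite eqn_leq; apply/andP; split.
  rewrite leqNgt; apply/negP => ik.
  have iltC : (i < n)%N := leq_trans ik (count_size _ _).
  have := nth_count_lt 0 sC ik.
  by rewrite ltNge; move: xBi; rewrite cell_boundsS// lee_fin => ->.
case: i iC Bix xBi => // i iC Bix _; rewrite leqNgt; apply/negP => ki.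
have := @nth_count_ge _ _ x 0 _ i sC; rewrite -ltnS ki => /(_ iC).
by rewrite leNgt; move: Bix; rewrite cell_boundsS// lte_fin => ->.
Qed.

Variable h : measurableTypeR R -> R.
Variables beta gamma : nat -> R.
Hypothesis hE : forall x, h x = beta (count (< x) C) + gamma (count (< x) C) * x.

Lemma measurable_piecewise_affine : measurable_fun setT h.
Proof.
(* Cells are added one at a time: [le (B 0)] is empty and [le (B n.+1)] is the whole line. *)
suff mle k : (k <= n.+1)%N -> measurable_fun (le (B k)) h.
  by have := mle _ (leqnn _); rewrite cell_bounds_last set_le_pinfty.
elim: k => [_|k ih kn]; first by rewrite set_le_ninfty; exact: measurable_fun_set0.
rewrite (set_le_setU_cell _ _ (cell_bounds_le _ kn)).
apply/measurable_funU; [exact: measurable_set_le|exact: measurable_cell|].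
split; first exact: ih (ltnW kn).
apply: (eq_measurable_fun (fun x => beta k + gamma k * x)).
  by move=> x; rewrite inE => /(cell_count _ _ kn) kE; rewrite hE kE.
by apply: measurable_funTS; apply: measurable_funD => //; exact: measurable_funM.
Qed.

Lemma integral_cells (f : measurableTypeR R -> R) (I : nat -> R) :
  measurable_fun setT f ->
  (forall i, (i <= n)%N ->
    (\int[N]_(x in cell (B i) (B i.+1)) (f x)%:E = (I i)%:E)%E) ->
  (\int[N]_x (f x)%:E = (\sum_(0 <= i < n.+1) I i)%:E)%E.
Proof.
move=> mf fI.
suff mle k : (k <= n.+1)%N ->
    (\int[N]_(x in le (B k)) (f x)%:E = (\sum_(0 <= i < k) I i)%:E)%E.
  by have := mle _ (leqnn _); rewrite cell_bounds_last set_le_pinfty.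
elim: k => [_|k ih kn]; first by rewrite set_le_ninfty integral_set0 big_geq.
rewrite (set_le_setU_cell _ _ (cell_bounds_le _ kn)) integral_setU.
- by rewrite ih ?fI// 1?ltnW// big_nat_recr.
- exact: measurable_set_le.
- exact: measurable_cell.
- by apply/measurable_funTS; exact/measurable_EFinP.
- exact: disjoint_set_le_cell.
Qed.

(** The integrals of 1, x and x^2 over cell i are [dcdf i], [- dpdf i] and [dcdf i - dxpdf i]. *)
Definition dcdf i := std_cdf (B i.+1) - std_cdf (B i).
Definition dpdf i := std_pdf (B i.+1) - std_pdf (B i).
Definition dxpdf i :=
  fine (B i.+1) * std_pdf (B i.+1) - fine (B i) * std_pdf (B i).

Lemma sum_dcdf : \sum_(0 <= i < n.+1) dcdf i = 1.
Proof.
rewrite telescope_sumr// cell_bounds_last /std_cdf.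
by rewrite set_le_pinfty set_le_ninfty measure0 probability_setT subr0.
Qed.

Lemma integral_piecewise_affine :
  (\int[N]_x (h x)%:E =
   (\sum_(0 <= i < n.+1) (beta i * dcdf i - gamma i * dpdf i))%:E)%E.
Proof.
apply: integral_cells => [|i iC]; first exact: measurable_piecewise_affine.
have := integral_poly2_cell (beta i) (gamma i) 0 _ _ (cell_bounds_le _ iC).
rewrite mul0r addr0 => <-; apply: eq_integral => x; rewrite inE.
by move=> /(cell_count _ _ iC) kE; rewrite hE kE mul0r addr0.
Qed.

Lemma integral_sqr_piecewise_affine (c : R) :
  (\int[N]_x ((h x - c) ^+ 2)%:E =
   (\sum_(0 <= i < n.+1) ((beta i - c) ^+ 2 * dcdf i
      - 2 * (beta i - c) * gamma i * dpdf i
      + gamma i ^+ 2 * (dcdf i - dxpdf i)))%:E)%E.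
Proof.
apply: integral_cells => [|i iC].
  apply: measurable_funX; apply: measurable_funB => //.
  exact: measurable_piecewise_affine.
have := integral_poly2_cell ((beta i - c) ^+ 2) (2 * (beta i - c) * gamma i)
  (gamma i ^+ 2) _ _ (cell_bounds_le _ iC).
move=> <-; apply: eq_integral => x; rewrite inE.
by move=> /(cell_count _ _ iC) kE; rewrite hE kE; congr EFin; ring.
Qed.

Context {d : measure_display} {T : measurableType d} (P : probability T R).
Variable W : T -> measurableTypeR R.
Hypothesis mW : measurable_fun setT W.
Hypothesis PW : forall A, measurable A -> P (W @^-1` A) = N A.

Lemma expectation_piecewise_affine :
  ('E_P[h \o W] =
   (\sum_(0 <= i < n.+1) (beta i * dcdf i - gamma i * dpdf i))%:E)%E.
Proof.
rewrite unlock (integral_law _ _ _ mW PW)//; last exact: measurable_piecewise_affine.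
exact: integral_piecewise_affine.
Qed.

(** The variance is the integral of (h - c)^2 with c the mean. Evaluating it directly, and expanding
    in c only within the finite sum, avoids any square-integrability condition; the expansion uses
    that the cell probabilities sum to 1. *)
Lemma variance_piecewise_affine :
  ('V_P[h \o W] =
   (\sum_(0 <= i < n.+1) (beta i ^+ 2 * dcdf i
      - 2 * beta i * gamma i * dpdf i + gamma i ^+ 2 * (dcdf i - dxpdf i))
    - (\sum_(0 <= i < n.+1) (beta i * dcdf i - gamma i * dpdf i)) ^+ 2)%:E)%E.
Proof.
rewrite /variance unlock expectation_piecewise_affine/=.
set c := \sum_(0 <= i < n.+1) (beta i * dcdf i - gamma i * dpdf i).
rewrite unlock.
transitivity (\int[P]_w ((h (W w) - c) ^+ 2)%:E)%E.
  by apply: eq_integral => w _; rewrite /= expr2.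
rewrite (integral_law _ _ _ mW PW (fun x => (h x - c) ^+ 2)); last first.
  apply: measurable_funX; apply: measurable_funB => //.
  exact: measurable_piecewise_affine.
rewrite integral_sqr_piecewise_affine; congr EFin.
transitivity (\sum_(0 <= i < n.+1) ((beta i ^+ 2 * dcdf i
      - 2 * beta i * gamma i * dpdf i + gamma i ^+ 2 * (dcdf i - dxpdf i))
    - 2 * c * (beta i * dcdf i - gamma i * dpdf i) + c ^+ 2 * dcdf i)).
  by apply: eq_bigr => i _; ring.
by rewrite big_split/= big_split/= sumrN -!mulr_sumr -/c sum_dcdf; ring.
Qed.

End piecewise_affine.

(** * Standardization of a normal law *)

Section standardization.
Context {R : realType}.
Variables (m s : R).
Hypothesis s0 : 0 < s.
Local Notation mu := (@lebesgue_measure R).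

Let F (y : R) : R := (y - m) / s.

Let dF (y : R) : is_derive y (1 : R) F s^-1.
Proof.
apply: is_derive_eq.
by rewrite /GRing.scale /=; ring.
Qed.

Let F'E : (F^`())%classic = cst s^-1.
Proof. by apply/funext => y; rewrite derive1E (@derive_val _ _ _ _ _ _ _ (dF y)). Qed.

Let derF (y : R) : derivable F y 1.
Proof. exact: (@ex_derive _ _ _ _ _ _ _ (dF y)). Qed.

Lemma normal_pdf_standardize (y : R) :
  normal_pdf m s y = normal_pdf 0 1 ((y - m) / s) / s.
Proof.
rewrite std_normal_pdfE normal_pdfE ?gt_eqF// mulrAC; congr (_ * _).
  rewrite /normal_peak expr1n mul1r -mulrnAr sqrtrM ?sqr_ge0// sqrtr_sqr.
  by rewrite ger0_norm ?ltW// invfM mulrC.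
rewrite /normal_fun; congr expR; field.
by rewrite gt_eqF.
Qed.

Lemma normal_prob_standardize_itvNy (t : R) :
  normal_prob m s (F @^-1` `]-oo, t]) = normal_prob 0 1 `]-oo, t].
Proof.
(* The substitution rule expects the bound of the half-line as a value of F. *)
have Ft : F (m + s * t) = t by rewrite /F addrC addKr mulrC mulKf ?gt_eqF.
rewrite (_ : F @^-1` `]-oo, t]%classic = `]-oo, m + s * t]%classic); last first.
  apply/seteqP; split => y /=; rewrite !in_itv/= /F ler_pdivrMr//.
    by rewrite lerBlDl mulrC.
  by rewrite lerBlDl mulrC.
rewrite /normal_prob -[in RHS]Ft.
rewrite (increasing_ge0_integration_by_substitutionNy (F := F)).
- apply: eq_integral => y _; congr EFin.
  by rewrite normal_pdf_standardize /= F'E.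
- by move=> x y _ _ xy; rewrite /F ltr_pM2r ?invr_gt0// ltrD2r.
- by rewrite F'E => x _; exact: cvg_cst.
- by rewrite F'E; exact: is_cvg_cst.
- by rewrite F'E; exact: cvg_cst.
- split => [x _|]; first exact: derF.
  apply: cvg_at_left_filter; apply: differentiable_continuous.
  exact/derivable1_diffP.
- apply: gt0_cvgMlNy; first by rewrite invr_gt0.
  exact: cvg_addrr_Ny.
- by apply: continuous_subspaceT; exact: continuous_normal_pdf.
- by move=> x _; exact: normal_pdf_ge0.
Qed.

(** The rays ]x, +oo[ generate the Borel sets and are stable under intersection, so two
    probabilities agreeing on them are equal; complements reduce them to the half-lines treated by
    substitution. *)
Lemma normal_prob_standardize (A : set (measurableTypeR R)) : measurable A ->
  normal_prob m s ((fun y => (y - m) / s) @^-1` A) = normal_prob 0 1 A.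
Proof.
have mF : measurable_fun setT (F : measurableTypeR R -> measurableTypeR R).
  by apply: measurable_funM => //; exact: measurable_funB.
pose Fm : {mfun measurableTypeR R >-> measurableTypeR R} := HB.pack F
  (@isMeasurableFun.Build _ _ (measurableTypeR R) (measurableTypeR R) F mF).
move=> mA; rewrite -[LHS]/(distribution (normal_prob m s) Fm A).
refine (@measure_unique _ R (measurableTypeR R) (@RGenOInfty.G R)
  (fun k : nat => `](- k%:R), +oo[%classic) _ _ _ _
  (distribution (normal_prob m s) Fm) (normal_prob 0 1) _ _ A mA).
- exact: RGenOInfty.measurableE.
- move=> _ _ [x ->] [y ->]; exists (Num.max x y); apply/seteqP.
  split => z /=; rewrite !in_itv/= !andbT gt_max; first by case=> -> ->.
  by move/andP.
- by move=> k; exists (- k%:R).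
- apply/seteqP; split => // x _; exists (Num.truncn (- x)).+1 => //=.
  by rewrite in_itv/= andbT ltrNl truncnS_gt.
- move=> _ [x ->].
  have mx : measurable (`]-oo, x]%classic : set (measurableTypeR R)) by [].
  rewrite (_ : `]x, +oo[%classic = ~` `]-oo, x]); last by rewrite setCitvl.
  apply: etrans (probability_setC (distribution (normal_prob m s) Fm) mx) _.
  apply: etrans _ (esym (probability_setC (normal_prob 0 1) mx)).
  congr (1 - _)%E; exact: normal_prob_standardize_itvNy.
- by move=> k; apply: (le_lt_trans _ (ltry 1)); exact: probability_le1.
Qed.

End standardization.

(** Source of the double sum of the criterion, with the same index ranges. *)
Lemma sqr_sum_nat {R : comNzRingType} (u : nat -> R) (n : nat) :
  (\sum_(1 <= i < n.+1) u i) ^+ 2 = \sum_(1 <= i < n.+1) u i ^+ 2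
    + 2 * \sum_(2 <= i < n.+1) \sum_(1 <= t < i) u i * u t.
Proof.
case: n => [|n]; first by rewrite !big_geq//; ring.
elim: n => [|n ih]; first by rewrite !big_nat1 big_geq//; ring.
rewrite (big_nat_recr n.+2)// sqrrD ih [in RHS](big_nat_recr n.+2)//=.
by rewrite [in RHS](big_nat_recr n.+2)//= -mulr_sumr; ring.
Qed.

(** * Moments of a Gaussian variable, degenerate case included *)

Section gaussian_moments.
Context {R : realType} {d : measure_display} {T : measurableType d}.
Variables (P : probability T R) (X : T -> measurableTypeR R) (m v : R).
Hypotheses (mX : measurable_fun setT X) (v0 : 0 <= v).
Hypothesis PX : forall A, measurable A -> P (X @^-1` A) = gaussian_law m v A.

Lemma measurable_standardize (s : R) :
  measurable_fun setT (fun w => (X w - m) / s : measurableTypeR R).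
Proof. by apply: measurable_funM => //; exact: measurable_funB. Qed.

Lemma gaussian_law_standardize (A : set (measurableTypeR R)) : v != 0 ->
  measurable A ->
  P ((fun w => (X w - m) / Num.sqrt v) @^-1` A) = normal_prob 0 1 A.
Proof.
move=> vn0 mA; have s0 : 0 < Num.sqrt v by rewrite sqrtr_gt0 lt_neqAle eq_sym vn0.
rewrite -(normal_prob_standardize m _ s0 A mA).
have mF : measurable_fun setT
    (fun y : measurableTypeR R => (y - m) / Num.sqrt v : measurableTypeR R).
  by apply: measurable_funM => //; exact: measurable_funB.
have := PX ((fun y => (y - m) / Num.sqrt v) @^-1` A).
rewrite /gaussian_law (negbTE vn0) => <- //.
by rewrite -[X in measurable X]setTI; exact: mF.
Qed.

(** Identifies the parameters that [gaussian_process] only asserts to exist. The case v = 0 is a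
    point mass; otherwise X is an affine function of a standard Gaussian variable. *)
Lemma gaussian_law_moments : ('E_P[X] = m%:E /\ 'V_P[X] = v%:E)%E.
Proof.
have [vE|vn0] := eqVneq v 0.
  pose delta := @dirac _ (measurableTypeR R) m R.
  have PX' A : measurable A -> P (X @^-1` A) = delta A.
    by move=> mA; rewrite PX// /gaussian_law vE eqxx.
  have deltaE (f : measurableTypeR R -> R) : measurable_fun setT f ->
      (\int[P]_w (f (X w))%:E = (f m)%:E)%E.
    move=> mf; rewrite (integral_law P X delta mX PX')// integral_dirac//.
      by rewrite diracE mem_set// mul1e.
    exact/measurable_EFinP.
  have EX : ('E_P[X] = m%:E)%E.
    by rewrite unlock (deltaE idfun)//; exact: measurable_id.
  split => //; rewrite /variance unlock EX unlock.
  transitivity (\int[P]_w (((X w : R) - m) ^+ 2)%:E)%E.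
    by apply: eq_integral => w _; rewrite /= expr2.
  rewrite (deltaE (fun x => (x - m) ^+ 2)); last by apply: measurable_funX; exact: measurable_funB.
  by rewrite subrr expr0n vE.
have s0 : 0 < Num.sqrt v by rewrite sqrtr_gt0 lt_neqAle eq_sym vn0.
pose h (x : measurableTypeR R) : R := m + Num.sqrt v * x.
have XE : X = h \o (fun w => (X w - m) / Num.sqrt v).
  by apply/funext => w; rewrite /h /= mulrC divfK ?gt_eqF// addrC subrK.
have hE x : h x = m + Num.sqrt v * x by [].
have mW := measurable_standardize (Num.sqrt v).
have PW A := gaussian_law_standardize A vn0.
(* An affine function is piecewise affine with no breakpoint: its single cell is the whole line, of
   probability 1 and without boundary terms. *)
have sC : sorted <=%R ([::] : seq R) by [].
have d0 : dpdf ([::] : seq R) 0 = 0 by rewrite /dpdf /= subrr.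
have e0 : dxpdf ([::] : seq R) 0 = 0 by rewrite /dxpdf /= mul0r subrr.
have P1 : dcdf ([::] : seq R) 0 = 1 by rewrite -(sum_dcdf [::]) big_nat1.
split; rewrite XE.
- rewrite (expectation_piecewise_affine _ sC h (fun=> m) (fun=> Num.sqrt v) hE P _ mW PW).
  by rewrite big_nat1 d0 P1 mulr0 mulr1 subr0.
- rewrite (variance_piecewise_affine _ sC h (fun=> m) (fun=> Num.sqrt v) hE P _ mW PW).
  by rewrite !big_nat1 d0 e0 P1 -[in RHS](sqr_sqrtr v0); congr EFin; ring.
Qed.

End gaussian_moments.

(** * Merging of adjacent intervals with the same percentile point *)

Lemma nth_cons_cat_size {T : Type} (x0 : T) (s1 s2 : seq T) :
  nth x0 (x0 :: s1 ++ s2) (size s1) = last x0 s1.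
Proof.
elim/last_ind: s1 => // s1 x _; rewrite size_rcons last_rcons /=.
by rewrite nth_cat size_rcons leqnn nth_rcons ltnn eqxx.
Qed.

(** An index is dropped exactly when y does not change there, so y is constant from a retained index
    up to the next one. *)
Lemma last_effective {T : eqType} (y : nat -> T) (i : nat) :
  last (y 0%N) [seq y e | e <- iota 1 i & y e.-1 != y e] = y i.
Proof.
elim: i => // i ih; rewrite -[in iota _ _](addn1 i) iotaD filter_cat map_cat last_cat ih /=.
by rewrite add1n /=; case: eqVneq.
Qed.

(** Merging does not alter the point attached to z: the retained abscissae below z are those whose
    index is at most the number of all abscissae below z. *)
Lemma effective_points_count {R : realType} {T : eqType} (s : seq R)
    (y : nat -> T) (z : R) : sorted <=%R s ->
  nth (y 0%N) (effective_points s y)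
    (count (< z) [seq nth 0 s i.-1 | i <- effective_indices s y]) =
  y (count (< z) s).
Proof.
move=> ss; set i := count _ s; have is_ : (i <= size s)%N := count_size _ _.
have ltE e : e \in iota 1 (size s) -> (nth 0 s e.-1 < z) = (e <= i)%N.
  rewrite mem_iota; case: e => // e /=; rewrite add1n ltnS => es.
  apply/idP/idP => [|ei]; last exact: nth_count_lt.
  apply: contraTT; rewrite -leNgt -leqNgt => ie.
  by apply: nth_count_ge => //; rewrite -/i ie.
have iotaE : iota 1 (size s) = iota 1 i ++ iota (1 + i) (size s - i).
  by rewrite -iotaD subnKC.
have countE : count [eta < z] [seq nth 0 s e.-1 | e <- effective_indices s y] =
    size [seq y e | e <- iota 1 i & y e.-1 != y e].
  rewrite count_map size_map.
  rewrite (@eq_in_count _ _ (fun e => e <= i)%N); last first.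
    by move=> e; rewrite mem_filter => /andP[_ /ltE].
  (* Retained indices up to i are all counted, those beyond i are not. *)
  rewrite /effective_indices iotaE filter_cat count_cat.
  rewrite (_ : count _ _ = size [seq e <- iota 1 i | y e.-1 != y e]).
    rewrite (_ : count _ _ = 0%N) ?addn0//.
    apply/eqP; rewrite -leqn0 leqNgt -has_count; apply/hasPn => e.
    by rewrite mem_filter mem_iota add1n -ltnNge => /andP[_ /andP[]].
  apply/eqP; rewrite -all_count; apply/allP => e.
  by rewrite mem_filter mem_iota add1n ltnS => /andP[_ /andP[]].
rewrite countE /effective_points /effective_indices iotaE filter_cat map_cat.
by rewrite nth_cons_cat_size last_effective.
Qed.

(** Converts breakpoints in z into breakpoints in W = s z; positivity of s fixes both infinities and
    the default value. *)
Lemma nth_cell_bounds_scale {R : realType} (s : R) (C : seq R) (k : nat) : 0 < s ->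
  nth +oo%E (cell_bounds [seq s * c | c <- C]) k =
  (s%:E * nth +oo%E (cell_bounds C) k)%E.
Proof.
move=> s0; have sy : (s%:E * +oo = +oo)%E by rewrite gt0_muley ?lte_fin.
have -> : cell_bounds [seq s * c | c <- C] =
    [seq (s%:E * t)%E | t <- cell_bounds C].
  rewrite /cell_bounds /= map_rcons gt0_muleNy ?lte_fin// sy -!map_comp.
  by congr (_ :: rcons _ _); apply: eq_map => c /=; rewrite EFinM.
have [kC|Ck] := ltnP k (size (cell_bounds C)); first by rewrite (nth_map +oo%E).
by rewrite !nth_default ?size_map.
Qed.

Lemma sorted_effective_bounds {R : realType} {T : eqType} (s : seq R)
    (y : nat -> T) : sorted <=%R s ->
  sorted <=%R [seq nth 0 s i.-1 | i <- effective_indices s y].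
Proof.
apply: (subseq_sorted le_trans).
have sE : s = [seq nth 0 s i.-1 | i <- iota 1 (size s)].
  by rewrite -[1%N]/(1 + 0)%N iotaDl -map_comp -[LHS](mkseq_nth 0).
rewrite [X in subseq _ X]sE; exact/map_subseq/filter_subseq.
Qed.

(** * Variance of the updated percentile estimator *)

Theorem proposition3p3
  (R : realType) (disp : measure_display) (Omega : measurableType disp)
  (dim : nat) (X : set 'rV[R]_dim)
  (* prior Gaussian process on X *)
  (P0 : probability Omega R) (G : X -> {RV P0 >-> R})
  (m0 : X -> R) (k0 : X -> X -> R)
  (hG0 : gaussian_process P0 G) (hm0 : mean_function P0 G m0)
  (hk0 : covariance_function P0 G k0)
  (* observations, and conditional law of G given them *)
  (n : nat) (x : 'I_n -> X) (g : X -> R)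
  (kappa : n.-tuple (measurableTypeR R) -> probability Omega R)
  (hkappa : conditional_law P0 (fun w => [tuple G (x i) w | i < n]) kappa)
  (mn : X -> R) (kn : X -> X -> R)
  (hGn : gaussian_process (kappa [tuple g (x i) | i < n]) G)
  (hmn : mean_function (kappa [tuple g (x i) | i < n]) G mn)
  (hkn : covariance_function (kappa [tuple g (x i) | i < n]) G kn)
  (* level, Monte Carlo points, candidate point *)
  (alpha : R) (halpha0 : 0 < alpha) (halpha1 : alpha < 1)
  (l : nat) (hl : (0 < l)%N) (xMC : 'I_l -> X)
  (xnew : X) (hs : 0 < kn xnew xnew)
  (* index of the percentile line on each interval *)
  (j : nat -> 'I_l) :
  let b := fun p => mn (xMC p) in
  let a := fun p => kn (xMC p) xnew in
  let cr := crossings b a in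
  (forall i : nat, (i <= size cr)%N ->
     percentile_line alpha b a (nth +oo%E (cell_bounds cr) i)
       (nth +oo%E (cell_bounds cr) i.+1) (j i)) ->
  let y := fun i => xMC (j i) in
  let L := size (effective_points cr y) in
  (* effective intervals [I i, I i.+1] and their points, for 1 <= i <= L *)
  let I := fun i : nat => nth +oo%E (effective_bounds cr y) i.-1 in
  let xq := fun i : nat => nth (y 0%N) (effective_points cr y) i.-1 in
  let s := Num.sqrt (kn xnew xnew) in
  let Pr := fun i => cell_P s (I i.+1) (I i) in
  let E := fun i => cell_E s (I i.+1) (I i) in
  let V := fun i => cell_V s (I i.+1) (I i) in
  J_Var (kappa [tuple g (x i) | i < n]) G mn kn alpha xMC xnew =
  (\sum_(1 <= i < L.+1) (kn (xq i) xnew) ^+ 2 * V i * Pr i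
   + \sum_(1 <= i < L.+1)
       (mn (xq i) - kn (xq i) xnew * E i) ^+ 2 * (1 - Pr i) * Pr i
   - 2 * \sum_(2 <= i < L.+1) \sum_(1 <= t < i)
       (mn (xq i) - kn (xq i) xnew * E i) * Pr i *
       ((mn (xq t) - kn (xq t) xnew * E t) * Pr t))%:E.
Proof.
move=> b a cr hline y L I xq s Pr E V.
set P := kappa _ in hGn hmn hkn *.
pose Y : Omega -> measurableTypeR R := G xnew.
have mY : measurable_fun setT Y by exact: (measurable_funPT (G xnew)).
(* The linear combination reduced to one point with coefficient 1. *)
have [m [v [v0 PY]]] : exists m v : R, 0 <= v /\
    forall A, measurable A -> P (Y @^-1` A) = gaussian_law m v A.
  have [m [v [v0 lawE]]] := hGn 1%N (fun=> xnew) (fun=> 1).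
  exists m, v; split => // A mA; rewrite -lawE//; congr (P _).
  by apply/funext => w; rewrite /= big_ord1 mul1r.
have [EY VY] := gaussian_law_moments P Y m v mY v0 PY.
have mE : m = mn xnew by move: EY; rewrite hmn => -[].
have vE : v = kn xnew xnew by move: VY; rewrite /variance hkn => -[].
(* [updated_mean] evaluates the covariance at (xnew, x), the slopes [a] at (x, xnew). *)
have knC p q : kn p q = kn q p.
  by have := hkn p q; rewrite covarianceC hkn => -[].
subst m v.
have s0 : 0 < s by rewrite sqrtr_gt0.
have s2 : s ^+ 2 = kn xnew xnew by rewrite sqr_sqrtr.
pose W w : measurableTypeR R := (Y w - mn xnew) / s.
have mW : measurable_fun setT W by exact: measurable_standardize.
have PW A : measurable A -> P (W @^-1` A) = normal_prob 0 1 A.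
  by move=> mA; apply: gaussian_law_standardize => //; rewrite gt_eqF.
(* The argument of h is the value of W; the abscissa on the lines is W / s, because (G(xnew) - mn
   xnew) / s^2 = W / s. *)
pose h (z : measurableTypeR R) : R :=
  percentile alpha (fun p => b p + a p * ((z : R) / s)).
have JE : J_Var P G mn kn alpha xMC xnew = ('V_P[h \o W])%E.
  congr (variance P _); apply/funext => w; congr (percentile alpha _).
  apply/funext => p; rewrite /updated_mean -s2 knC -[G xnew w]/(Y w).
  rewrite /b /a /W; congr (_ + _ * _); field.
  by rewrite gt_eqF.
have scr : sorted <=%R cr by exact: sort_le_sorted.
pose C := [seq nth 0 cr i.-1 | i <- effective_indices cr y].
have sC : sorted <=%R C by exact: sorted_effective_bounds.
have sCs : sorted <=%R [seq s * c | c <- C].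
  by apply: homo_sorted sC => c1 c2; rewrite ler_pM2l.
(* Cells count from 0 here and from 1 in the formula: [xq k.+1] is [q k]. *)
pose q k := nth (y 0%N) (effective_points cr y) k.
pose beta k := mn (q k).
pose gamma k := kn (q k) xnew / s.
have hE z : h z = beta (count (< z) [seq s * c | c <- C])
    + gamma (count (< z) [seq s * c | c <- C]) * z.
  rewrite count_map (@eq_count _ _ (fun c => c < (z : R) / s)); last first.
    by move=> c /=; rewrite ltr_pdivlMr// mulrC.
  rewrite /beta /gamma /q effective_points_count// mulrAC -mulrA.
  (* The effective point is now that of the original interval containing z / s, to which [hline]
     applies. *)
  have /andP[lo hi] := count_cell cr scr (z / s).
  by apply/esym/(hline _ (count_size _ _)); rewrite (ltW lo) hi.
rewrite JE (variance_piecewise_affine _ sCs h beta gamma hE P W mW PW).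
rewrite size_map; congr EFin.
have LE : L = (size C).+1 by rewrite /L /= !size_map.
have PrE k : dcdf [seq s * c | c <- C] k = Pr k.+1.
  by rewrite /dcdf !nth_cell_bounds_scale.
pose d k := dpdf [seq s * c | c <- C] k.
pose e k := dxpdf [seq s * c | c <- C] k.
have EE k : E k.+1 = s^-1 * (d k / Pr k.+1).
  by rewrite -PrE /d /dpdf /dcdf !nth_cell_bounds_scale.
have VE k : V k.+1 =
    (s ^+ 2)^-1 * (1 - e k / Pr k.+1 - (d k / Pr k.+1) ^+ 2).
  by rewrite -PrE /e /d /dxpdf /dpdf /dcdf !nth_cell_bounds_scale.
have null k : (k <= size C)%N -> Pr k.+1 = 0 -> d k = 0 /\ e k = 0.
  rewrite -PrE => kC /eqP; rewrite subr_eq0 => /eqP cdfE.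
  have kC' : (k <= size [seq (s * c)%R | c <- C])%N by rewrite size_map.
  have [pE xE] := std_cdf_eq _ _ (cell_bounds_le _ sCs _ kC') cdfE.
  by rewrite /d /e /dpdf /dxpdf xE pE !subrr.
(* Contribution of cell i to the expectation of q_{n+1}: conditional mean times probability. *)
pose u i := (mn (xq i) - kn (xq i) xnew * E i) * Pr i.
have uE k : (k <= size C)%N ->
    beta k * dcdf [seq s * c | c <- C] k - gamma k * d k = u k.+1.
  move=> kC; rewrite /u -[xq _]/(q k) PrE EE /beta /gamma.
  have [P0'|Pn0] := eqVneq (Pr k.+1) 0.
    by have [-> _] := null _ kC P0'; rewrite P0' !mulr0 subr0.
  by field; rewrite Pn0 gt_eqF.
(* With c the conditional mean on the cell and p its probability, the second moment is the
   conditional variance times p plus c^2 p, and c^2 p = c^2 (1 - p) p + (c p)^2. *)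
have m2E k : (k <= size C)%N ->
    beta k ^+ 2 * dcdf [seq s * c | c <- C] k - 2 * beta k * gamma k * d k
      + gamma k ^+ 2 * (dcdf [seq s * c | c <- C] k - e k) =
    kn (xq k.+1) xnew ^+ 2 * V k.+1 * Pr k.+1
      + (mn (xq k.+1) - kn (xq k.+1) xnew * E k.+1) ^+ 2 * (1 - Pr k.+1)
        * Pr k.+1 + u k.+1 ^+ 2.
  move=> kC; rewrite /u -[xq _]/(q k) PrE EE VE /beta /gamma.
  have [P0'|Pn0] := eqVneq (Pr k.+1) 0.
    have [-> ->] := null _ kC P0'; rewrite P0'; ring.
  by field; rewrite Pn0 gt_eqF.
rewrite LE (eq_big_nat _ _ (F2 := fun k =>
    kn (xq k.+1) xnew ^+ 2 * V k.+1 * Pr k.+1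
      + (mn (xq k.+1) - kn (xq k.+1) xnew * E k.+1) ^+ 2 * (1 - Pr k.+1)
        * Pr k.+1 + u k.+1 ^+ 2)); last by move=> k /andP[_ kC]; exact: m2E.
rewrite (eq_big_nat _ _ (F1 := fun k => beta k * _ - _) (F2 := fun k => u k.+1));
  last by move=> k /andP[_ kC]; exact: uE.
have shift F : \sum_(0 <= k < (size C).+1) F k.+1 =
    \sum_(1 <= i < (size C).+2) F i :> R by rewrite big_add1.
rewrite !big_split/= (shift (fun i => kn (xq i) xnew ^+ 2 * V i * Pr i)).
rewrite (shift (fun i =>
  (mn (xq i) - kn (xq i) xnew * E i) ^+ 2 * (1 - Pr i) * Pr i)).
rewrite (shift (fun i => u i ^+ 2)) (shift u) sqr_sum_nat.
(* The squares of u cancel against the diagonal of the squared expectation; only the cross terms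
   survive. *)
set S2 := \sum_(1 <= i < _) u i ^+ 2; set S3 := \sum_(2 <= i < _) _.
by rewrite -[X in _ = _ - 2 * X]/S3; ring.
Qed.
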